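(* Let $S$ be an idempotent semiring. Then the following conditions are equivalent: (1) $\mathcal{L}^+$ is the least distributive lattice congruence on $S$; (2) $S\in\mathbf{LN}$ and $\mathcal{D}^{\bullet}\subseteq\mathcal{L}^+$; (3) $S\in\mathbf{N}$ and $\mathcal{R}^+\subseteq\mathcal{D}^{\bullet}\subseteq\mathcal{L}^+$; (4) $\leq^{l}_{+}\;\subseteq\;\leq_{\cdot}$ on $S$; (5) $S$ satisfies the identity $x=(x+y)x(x+y)$; (6) $S$ satisfies the identity $x=x+yxy$.
   Context: A semiring $(S,+,\cdot)$ is a set with two associative binary operations such that $x(y+z)=xy+xz$ and $(x+y)z=xz+yz$ (no commutativity assumed). An idempotent semiring is a semiring satisfying $x+x=x$ and $x\cdot x=x$. $\mathcal{L}^+,\mathcal{R}^+$ denote Green's relations of $(S,+)$ and $\mathcal{D}^{\bullet}$ denotes Green's relation $\mathcal{D}$ of $(S,\cdot)$; for an idempotent semiring: $a\,\mathcal{L}^+\,b$ iff $a+b=a$ and $b+a=b$; $a\,\mathcal{R}^+\,b$ iff $a+b=b$ and $b+a=a$; $a\,\mathcal{D}^{\bullet}\,b$ iff $aba=a$ and $bab=b$. The relations $\leq^l_+$ and $\leq_\cdot$ are defined by: $a\leq^l_+ b$ iff $b=a+b$; $a\leq_\cdot b$ iff $a=ba$ and $a=ab$. $\mathbf{N}$ is the variety of idempotent semirings satisfying $x+xyx+x=x$, and $\mathbf{LN}$ is the variety of idempotent semirings satisfying $x+xyx=x$. A distributive lattice is regarded as a semiring (join as $+$, meet as $\cdot$);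 a distributive lattice congruence on $S$ is a semiring congruence whose quotient is a distributive lattice. *)

(* Defs.v *)
From Corelib Require Export RelationClasses Morphisms.
From mathcomp Require Export ssreflect ssrfun ssrbool eqtype ssrnat seq.

Set Implicit Arguments.
Unset Strict Implicit.
Unset Printing Implicit Defensive.

(* Neither operation is assumed commutative and there is no 0 or 1, so this is
   weaker than MathComp's [pzSemiRingType]. *)
Record semiring := Semiring {
  carrier :> Type;
  add : carrier -> carrier -> carrier;
  mul : carrier -> carrier -> carrier;
  addA : associative add;
  mulA : associative mul;
  mulDr : right_distributive mul add;
  mulDl : left_distributive mul add
}.

Declare Scope semiring_scope.
Delimit Scope semiring_scope with S.
Notation "x + y" := (add x y) : semiring_scope.
Notation "x * y" := (mul x y) : semiring_scope.
Local Open Scope semiring_scope.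

Definition idempotent_semiring (S : semiring) : Prop :=
  (forall x : S, x + x = x) /\ (forall x : S, x * x = x).

Section Green.

Variables (T : Type) (op : T -> T -> T).

(* The principal one-sided ideals T^1 a and a T^1. *)
Definition left_ideal (a x : T) : Prop := x = a \/ exists s, x = op s a.
Definition right_ideal (a x : T) : Prop := x = a \/ exists s, x = op a s.

Definition greenL (a b : T) : Prop :=
  forall x, left_ideal a x <-> left_ideal b x.
Definition greenR (a b : T) : Prop :=
  forall x, right_ideal a x <-> right_ideal b x.
Definition greenD (a b : T) : Prop := exists c, greenL a c /\ greenR c b.

End Green.

Definition Lplus (S : semiring) : S -> S -> Prop := greenL (@add S).
Definition Rplus (S : semiring) : S -> S -> Prop := greenR (@add S).
Definition Ddot (S : semiring) : S -> S -> Prop := greenD (@mul S).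

Definition leL_plus (S : semiring) (a b : S) : Prop := b = a + b.
Definition le_dot (S : semiring) (a b : S) : Prop := a = b * a /\ a = a * b.

Definition in_N (S : semiring) : Prop :=
  idempotent_semiring S /\ forall x y : S, x + x * y * x + x = x.
Definition in_LN (S : semiring) : Prop :=
  idempotent_semiring S /\ forall x y : S, x + x * y * x = x.

Record semiring_congruence (S : semiring) (rho : S -> S -> Prop) : Prop := {
  cong_equiv : Equivalence rho;
  cong_add : Proper (rho ==> rho ==> rho)%signature (@add S);
  cong_mul : Proper (rho ==> rho ==> rho)%signature (@mul S)
}.

(* The distributive lattice laws on the setoid (T, E); with [E := eq] these are
   the usual laws on [T], and with [E] a congruence they are the laws on the
   quotient of [T] by [E]. *)
Record distributive_lattice (T : Type) (E : T -> T -> Prop)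
    (join meet : T -> T -> T) : Prop := {
  joinC : forall x y, E (join x y) (join y x);
  meetC : forall x y, E (meet x y) (meet y x);
  joinA : forall x y z, E (join x (join y z)) (join (join x y) z);
  meetA : forall x y z, E (meet x (meet y z)) (meet (meet x y) z);
  joinKI : forall x y, E (meet x (join x y)) x;
  meetKU : forall x y, E (join x (meet x y)) x;
  meetUr : forall x y z, E (meet x (join y z)) (join (meet x y) (meet x z))
}.

Definition distributive_lattice_congruence
    (S : semiring) (rho : S -> S -> Prop) : Prop :=
  semiring_congruence rho /\ distributive_lattice rho (@add S) (@mul S).

Definition least_distributive_lattice_congruence
    (S : semiring) (rho : S -> S -> Prop) : Prop :=
  distributive_lattice_congruence rho /\
  forall sigma : S -> S -> Prop,
    distributive_lattice_congruence sigma -> subrelation rho sigma.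

(* Main.v *)
Require Import Defs.

Set Implicit Arguments.
Unset Strict Implicit.
Unset Printing Implicit Defensive.

(** Everything is governed by the absorption laws [x * (x + y) = x] and
    [(x + y) * x = x].

    In a band Green's relations are equational, so every condition becomes a
    statement about identities.  As [x] always lies below [x + y] for
    [leL_plus], the inclusion of [leL_plus] in [le_dot] gives both absorption
    laws.  The two identities [x = (x + y) x (x + y)] and [x = x + y x y] encode
    the same pair: multiply the first by [x + y] on either side, or substitute
    [x y] and [y x] for [y] in the second.

    Absorption in turn forces [x + y + x = x + y] and [x y + y x = x y].  The
    first makes the additive band left regular, which turns L^+ into a
    congruence and gives [x + y] L^+ [y + x] (see [add_left_regular] and
    [Lplus_congruence]); the second ([add_mulC]) gives [x y] L^+ [y x].  Hence
    S / L^+ is a distributive lattice, and L^+ is the least such congruence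
    because in any lattice quotient the equations [a = a + b] and [b = b + a]
    identify [a] with [b].

    Conversely, when S / L^+ is a lattice, L^+ contains D because D-related
    elements are identified in every lattice quotient, and the law
    [x + x y x] L^+ [x] is an equality in disguise, since [x] is a left summand
    of the other side.  Absorption is recovered from such inclusions between
    Green's relations because [b = a + b] yields [a b a = a + a b a], which LN,
    or N together with the inclusions, collapses to [a]
    ([N_Green_leL_plus_sub_le_dot]). *)

Local Open Scope semiring_scope.

(** * Green's relations of a band *)

Section Band.

Variables (T : Type) (op : T -> T -> T).
Hypothesis opA : associative op.
Hypothesis opxx : forall x, op x x = x.

Lemma band_greenLP a b : greenL op a b <-> op a b = a /\ op b a = b.
Proof.
(* [op s b] is fixed by right multiplication by [b], so a principal left ideal
   consists of the elements that its generator fixes on the right. *)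
have idealP c x : left_ideal op c x <-> op x c = x.
  split=> [[->|[s ->]]|<-]; first exact: opxx.
    by rewrite -opA opxx.
  by right; exists x.
split=> [eqab | [ab ba] x].
  split; apply/idealP; first by apply/(eqab a); left.
  by apply/(eqab b); left.
split=> /idealP xE; apply/idealP.
  by rewrite -xE -opA ab.
by rewrite -xE -opA ba.
Qed.

End Band.

Lemma band_greenRP (T : Type) (op : T -> T -> T) (opA : associative op)
    (opxx : forall x, op x x = x) a b :
  greenR op a b <-> op b a = a /\ op a b = b.
Proof.
(* [greenR] is [greenL] of the opposite band. *)
by apply: (@band_greenLP T (fun x y => op y x)).
Qed.

Lemma band_greenDP (T : Type) (op : T -> T -> T) (opA : associative op)
    (opxx : forall x, op x x = x) a b :
  greenD op a b <-> op (op a b) a = a /\ op (op b a) b = b.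
Proof.
split=> [[c [/(band_greenLP opA opxx)[ac ca] /(band_greenRP opA opxx)[bc cb]]]
        | [aba bab]].
  have abc : op (op a b) c = a by rewrite -opA bc ac.
  have cab : op c (op a b) = b by rewrite opA ca cb.
  split; first by rewrite -{2}abc opA opxx abc.
  by rewrite -{1}cab -!opA (opA a b) opxx cab.
exists (op b a); split.
  by apply/(band_greenLP opA opxx); rewrite opA aba -opA opxx.
by apply/(band_greenRP opA opxx); rewrite opA opxx bab.
Qed.

(** * Green's relations and lattice congruences of an idempotent semiring *)

Section IdempotentSemiring.

Variable S : semiring.
Hypothesis idemS : idempotent_semiring S.
Implicit Types a b c x y z : S.

Let addxx x : x + x = x. Proof. by case: idemS. Qed.
Let mulxx x : x * x = x. Proof. by case: idemS. Qed.

Lemma LplusP a b : Lplus a b <-> a + b = a /\ b + a = b.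
Proof. exact: (band_greenLP (@addA S) addxx). Qed.

Lemma RplusP a b : Rplus a b <-> b + a = a /\ a + b = b.
Proof. exact: (band_greenRP (@addA S) addxx). Qed.

Lemma DdotP a b : Ddot a b <-> a * b * a = a /\ b * a * b = b.
Proof. exact: (band_greenDP (@mulA S) mulxx). Qed.

(** D-related elements satisfy [a = a b a] and [b = b a b], and in a quotient
    with commutative multiplication both right-hand sides become [a b]. *)
Lemma Ddot_sub_lattice_congruence (rho : S -> S -> Prop) :
  distributive_lattice_congruence rho -> subrelation (@Ddot S) rho.
Proof.
case=> -[rhoE _ rhoM] [_ rhoC _ _ _ _ _] a b /DdotP[aba bab].
transitivity (a * b).
  have abE : a * b = a * (a * b) by rewrite mulA mulxx.
  rewrite -{1}aba -mulA abE.
  exact: (rhoM _ _ (reflexivity a) _ _ (rhoC b a)).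
have abE : a * b = a * b * b by rewrite -mulA mulxx.
rewrite -{2}bab abE.
exact: (rhoM _ _ (rhoC a b) _ _ (reflexivity b)).
Qed.

(** In a lattice quotient [a = a + b] and [b = b + a] agree by commutativity. *)
Lemma Lplus_sub_lattice_congruence (rho : S -> S -> Prop) :
  distributive_lattice_congruence rho -> subrelation (@Lplus S) rho.
Proof.
by case=> _ [rhoC _ _ _ _ _ _] a b /LplusP[ab ba]; rewrite -ab -{2}ba; apply: rhoC.
Qed.

(** The quotient law [x + x y x] L^+ [x] is an equality because [x] is already a
    left summand of [x + x y x]. *)
Lemma Lplus_lattice_congruence_LN :
  distributive_lattice_congruence (@Lplus S) -> in_LN S.
Proof.
case=> _ [_ _ _ _ _ rhoKU _]; split=> // x y.
by have /LplusP[_] := rhoKU x (y * x); rewrite !mulA addA addxx.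
Qed.

(** * From the Green inclusions to absorption *)

(** Since [b = a + b], distributivity and [LN] give
    [a b a = a (a + b) a = a + a b a = a]. *)
Lemma LN_Rplus_sub_Ddot : in_LN S -> subrelation (@Rplus S) (@Ddot S).
Proof.
case=> _ absLN a b /RplusP[ba ab]; apply/DdotP; split.
  by rewrite -{1}ab mulDr mulDl !mulxx absLN.
by rewrite -{1}ba mulDr mulDl !mulxx absLN.
Qed.

(** Elements related by both R^+ and L^+ are equal, so the inclusions of R^+ in
    D and of D in L^+ make R^+ trivial.  When [b = a + b], the
    identity of [N] makes [a] and [a b a] R^+-related, so [a = a b a].  Then [a]
    is D-related, hence L^+-related, to [a b] and to [b a].  So [a + a b] equals
    [a] by L^+ and [a b] by [b = a + b], and likewise for [b a]. *)
Lemma N_Green_leL_plus_sub_le_dot :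
  in_N S -> subrelation (@Rplus S) (@Ddot S) ->
  subrelation (@Ddot S) (@Lplus S) -> subrelation (@leL_plus S) (@le_dot S).
Proof.
case=> _ absN subRD subDL a b bE.
have a_ab : a + a * b = a * b by rewrite {2}bE mulDr mulxx.
have a_ba : a + b * a = b * a by rewrite {2}bE mulDl mulxx.
have a_aba : a + a * b * a = a * b * a.
  by rewrite -a_ab mulDl mulxx addA addxx.
have aba : a * b * a = a.
  have /subRD/subDL/LplusP[aE _] : Rplus a (a * b * a).
    by apply/RplusP; split=> //; rewrite -{1}a_aba absN.
  by rewrite -a_aba.
split.
  have /subDL/LplusP[aE _] : Ddot a (b * a).
    apply/DdotP; split; first by rewrite mulA -mulA mulxx.
    by rewrite -(mulA b a a) !mulxx.
  by rewrite -a_ba aE.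
have /subDL/LplusP[aE _] : Ddot a (a * b).
  by apply/DdotP; rewrite mulA mulxx aba mulA mulxx.
by rewrite -a_ab aE.
Qed.

(** * Absorption and the quotient by L^+ *)

Lemma leL_plus_sub_le_dot_absorb :
  subrelation (@leL_plus S) (@le_dot S) ->
  forall x y, (x + y) * x * (x + y) = x.
Proof.
move=> sub x y.
have [<- <-//] : le_dot x (x + y) by apply: sub; rewrite /leL_plus addA addxx.
Qed.

Lemma sandwich_absorb :
  (forall x y, x = (x + y) * x * (x + y)) -> forall x y, x = x + y * x * y.
Proof.
move=> sandwich x y.
have absl : x + y * x = x.
  by rewrite -{1}(mulxx x) -mulDl {2}(sandwich x y) !mulA mulxx -sandwich.
have absr : x + x * y = x.
  by rewrite -{1}(mulxx x) -mulDr {1}(sandwich x y) -mulA mulxx -sandwich.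
by rewrite -{1}absl -{2}absr mulDr addA absl mulA.
Qed.

Section Absorption.

Hypothesis absorb : forall x y, x = x + y * x * y.

Lemma addKmulr x y : x + x * y = x.
Proof. by rewrite {3}(absorb x (x * y)) -(mulA (x * y)) (mulA x x) !mulxx. Qed.

Lemma addKmull x y : x + y * x = x.
Proof. by rewrite {3}(absorb x (y * x)) -(mulA y) !mulxx. Qed.

Lemma add_left_regular x y : x + y + x = x + y.
Proof.
(* Absorption rewrites the last [x] as the multiple [(x + y) * x] of [x + y]. *)
by rewrite -{2}(addKmull x y) -{2}(mulxx x) -mulDl addKmulr.
Qed.

(** [y x = y (x y) x] is reached from [x y] by multiplying by [y] on the left and
    then by [x] on the right, and every such multiple is absorbed. *)
Lemma add_mulC x y : x * y + y * x = x * y.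
Proof.
rewrite -{1}(addKmull (x * y) y) -(mulxx (y * x)) -addA.
by rewrite (mulA _ y x) -(mulA y x y) addKmulr addKmull.
Qed.

Lemma Lplus_congruence : semiring_congruence (@Lplus S).
Proof.
have LplusE : Equivalence (@Lplus S).
  by split=> [a x|a b ab x|a b c ab bc x]; [|rewrite ab|rewrite ab].
split=> //.
- move=> a b /LplusP[ab ba] c d /LplusP[cd dc]; apply/LplusP.
  have add_sub (u v w t : S) : u + v = u -> w + t = w -> u + w + (v + t) = u + w.
    move=> uv wt.
    (* With [u] written as [u + v], left regularity deletes the later [v]. *)
    rewrite -{1}uv !addA -(addA u v w) -(addA u (v + w) v) add_left_regular.
    by rewrite addA uv -addA wt.
  by split; apply: add_sub.
- move=> a b /LplusP[ab ba] c d /LplusP[cd dc].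
  transitivity (b * c); apply/LplusP.
    by rewrite -!mulDl ab ba.
  by rewrite -!mulDr cd dc.
Qed.

Lemma Lplus_distributive_lattice :
  distributive_lattice (@Lplus S) (@add S) (@mul S).
Proof.
have eqL a b : a = b -> Lplus a b by move=> ->; apply/LplusP.
have addC_sub x y : x + y + (y + x) = x + y.
  by rewrite addA -(addA x) addxx add_left_regular.
split=> *; try by [apply: eqL; rewrite ?addA ?mulA].
- by apply/LplusP.
- by apply/LplusP; rewrite !add_mulC.
- by apply: eqL; rewrite mulDr mulxx addKmulr.
- exact/eqL/addKmulr.
- exact/eqL/mulDr.
Qed.

End Absorption.

End IdempotentSemiring.

(** * The equivalence *)

Theorem theorem3p7 (S : semiring) (idemS : idempotent_semiring S) :
  [<-> least_distributive_lattice_congruence (@Lplus S);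
       in_LN S /\ subrelation (@Ddot S) (@Lplus S);
       in_N S /\
         (subrelation (@Rplus S) (@Ddot S) /\ subrelation (@Ddot S) (@Lplus S));
       subrelation (@leL_plus S) (@le_dot S);
       forall x y : S, x = (x + y) * x * (x + y);
       forall x y : S, x = x + y * x * y].
Proof.
tfae.
- case=> latL _; split; first exact: Lplus_lattice_congruence_LN.
  exact: Ddot_sub_lattice_congruence.
- case=> LN subDL; split; last by split=> //; apply: LN_Rplus_sub_Ddot.
  by case: LN => _ absLN; split=> // x y; rewrite absLN; case: idemS.
- by case=> N [subRD subDL]; apply: N_Green_leL_plus_sub_le_dot.
- by move=> sub x y; rewrite leL_plus_sub_le_dot_absorb.
- exact: sandwich_absorb.
- move=> absorb; split; last exact: Lplus_sub_lattice_congruence.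
  by split; [apply: Lplus_congruence | apply: Lplus_distributive_lattice].
Qed.
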